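(* Let \(G=(V,E)\) be a simple, undirected, connected graph that is not a cactus but such that for every \(e\in E\) the graph \(G-e\) is a cactus. Then for any two edges \(e_1=a_1b_1\) and \(e_2=a_2b_2\) of \(G\), there exists a cycle \(C\) in \(G\) that contains both \(e_1\) and \(e_2\).
   Context: A cactus is a connected graph in which every edge belongs to at most one (simple) cycle; equivalently, a connected graph in which no two distinct cycles share an edge. \(G-e\) denotes the graph \((V,E\setminus\{e\})\). *)

(* Defs.v *)
From mathcomp Require Import all_boot.

Set Implicit Arguments.
Unset Strict Implicit.
Unset Printing Implicit Defensive.

(* No finiteness is imposed on the vertex set.  An edge {a, b} is handled
   through either of its orientations (a, b), (b, a). *)
Record sgraph (V : eqType) := SGraph {
  adj :> rel V;
  adj_sym : symmetric adj;
  adj_irr : irreflexive adj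
}.

Section Graphs.
Variable V : eqType.
Implicit Types (G : sgraph V) (c d : seq V) (a b x y : V).

Definition same_edge a b x y : bool :=
  ((x == a) && (y == b)) || ((x == b) && (y == a)).

Lemma same_edge_sym a b : symmetric (same_edge a b).
Proof.
by move=> x y; rewrite /same_edge orbC andbC [(x == a) && _]andbC.
Qed.

Definition del_adj G a b : rel V :=
  fun x y => adj G x y && ~~ same_edge a b x y.

Lemma del_adj_sym G a b : symmetric (del_adj G a b).
Proof. by move=> x y; rewrite /del_adj adj_sym same_edge_sym. Qed.

Lemma del_adj_irr G a b : irreflexive (del_adj G a b).
Proof. by move=> x; rewrite /del_adj adj_irr. Qed.

Definition del_edge G a b : sgraph V :=
  SGraph (del_adj_sym G a b) (del_adj_irr G a b).

Definition connected G : Prop :=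
  forall x y, exists2 p : seq V, path G x p & last x p = y.

(* A cycle is given by the cyclic list of its pairwise distinct vertices. *)
Definition is_cycle G c : bool := (2 < size c) && ucycleb G c.

(* [next c a] is a itself when a is not in c, hence the membership tests. *)
Definition cycle_edge c a b : bool :=
  ((a \in c) && (next c a == b)) || ((b \in c) && (next c b == a)).

(* Lists differing by a rotation or a reversal describe the same cycle, so
   cycles are compared as subgraphs, through their edge sets. *)
Definition same_cycle c d : Prop :=
  forall x y, cycle_edge c x y = cycle_edge d x y.

Definition cactus G : Prop :=
  connected G /\
  forall a b, adj G a b ->
  forall c d, is_cycle G c -> is_cycle G d ->
    cycle_edge c a b -> cycle_edge d a b -> same_cycle c d.

End Graphs.

(* Main.v *)
Require Import Defs.
From mathcomp Require Import all_boot.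
From Stdlib Require Import Classical.

(** If two distinct cycles share an edge, every edge of [G] lies on one of
    them: otherwise deleting an edge off both would leave a non-cactus.
    Fix such cycles [c] and [d] with common edge [f].  The only case left is
    [e1] on [c] but not on [d], and [e2] on [d] but not on [c].  Rerouting
    [c - e1] along [d - f] joins the ends of [e1] without using [e1] or [f],
    so [e1] lies on a cycle [z] avoiding [f].  Then [z] and [c] are distinct
    and share [e1], hence together they cover [G], and [e2] lies on [z]. *)

Set Implicit Arguments.
Unset Strict Implicit.
Unset Printing Implicit Defensive.

Section Reachability.
Variable V : eqType.
Implicit Types (e : rel V) (x y z : V).

Definition reach e x y : Prop := exists2 p, path e x p & last x p = y.

Lemma reach_refl e x : reach e x x.
Proof. by exists [::]. Qed.

Lemma reach_trans e x y z : reach e x y -> reach e y z -> reach e x z.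
Proof.
move=> [p ep <-] [q eq <-]; exists (p ++ q); first by rewrite cat_path ep.
by rewrite last_cat.
Qed.

Lemma reach_sym e x y : symmetric e -> reach e x y -> reach e y x.
Proof.
move=> e_sym [p ep <-]; exists (rev (belast x p)); last first.
  by case: p {ep} => //= z p; rewrite rev_cons last_rcons.
by rewrite rev_path (eq_path (e' := e)) // => u v; rewrite e_sym.
Qed.

(** The hypothesis provides a walk rather than a single step, so that one edge of a walk can be
    replaced by a detour. *)
Lemma reach_sub e e' x y :
  (forall u v, e u v -> reach e' u v) -> reach e x y -> reach e' x y.
Proof.
move=> ee' [p ep <-]; elim: p x ep => [|z p IHp] x /=.
  by move=> _; apply: reach_refl.
by case/andP=> /ee' xz /IHp; apply: reach_trans.
Qed.

End Reachability.

Section Cycles.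
Variables (V : eqType) (G : sgraph V).
Implicit Types (c d : seq V) (a b x y : V) (e : rel V).

Lemma cycle_edge_sym c : symmetric (cycle_edge c).
Proof. by move=> x y; rewrite /cycle_edge orbC. Qed.

Lemma cycle_edge_same c a b x y :
  same_edge a b x y -> cycle_edge c x y = cycle_edge c a b.
Proof.
by case/orP=> /andP[/eqP-> /eqP->] //; apply: cycle_edge_sym.
Qed.

Lemma cycle_edge_next c x : x \in c -> cycle_edge c x (next c x).
Proof. by move=> cx; rewrite /cycle_edge cx eqxx. Qed.

Lemma cycle_edge_rel e c x y :
  symmetric e -> cycle e c -> cycle_edge c x y -> e x y.
Proof.
move=> e_sym ec /orP[] /andP[cx /eqP <-]; first exact: next_cycle.
by rewrite e_sym; apply: next_cycle.
Qed.

Lemma cycle_edge_adj c x y : is_cycle G c -> cycle_edge c x y -> adj G x y.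
Proof.
by case/and3P=> _ Gc _; apply: cycle_edge_rel Gc; apply: adj_sym.
Qed.

Lemma is_cycle_del c a b :
  is_cycle G c -> ~~ cycle_edge c a b -> is_cycle (del_edge G a b) c.
Proof.
case/and3P=> c_gt2 Gc Uc ab'c; apply/and3P; split=> //.
apply/cycle_from_next => // x cx; rewrite /= /del_adj next_cycle //=.
by apply: contra ab'c => /(cycle_edge_same c) <-; apply: cycle_edge_next.
Qed.

(** Rotated to start at [x], the cycle reads [x], [next c x], and so on; the walk runs through the
    rest of the list and returns to [x]. *)
Lemma reach_cycle_del c a b : is_cycle G c -> cycle_edge c a b ->
  reach (fun x y => cycle_edge c x y && ~~ same_edge a b x y) a b.
Proof.
move=> Gc; pose e a b x y := cycle_edge c x y && ~~ same_edge a b x y.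
have e_sym a' b' : symmetric (e a' b').
  by move=> x y; rewrite /e cycle_edge_sym same_edge_sym.
suffices next_reach x : x \in c -> reach (e x (next c x)) (next c x) x.
  case/orP=> /andP[cx /eqP Dx].
    by apply: reach_sym; [apply: e_sym | rewrite -{1 2}Dx; apply: next_reach].
  have := next_reach _ cx; rewrite Dx; apply: reach_sub => u v.
  rewrite /e => uv; exists [:: v] => //=; rewrite andbT.
  by move: uv; rewrite /same_edge orbC.
move=> cx; case/and3P: Gc => c_gt2 _ Uc.
have [i s Ds] := rot_to cx.
have Us : uniq (x :: s) by rewrite -Ds rot_uniq.
have Nx u : next c u = next (x :: s) u by rewrite -Ds next_rot.
have Mx u : (u \in c) = (u \in x :: s) by rewrite -Ds mem_rot.
have: 2 < size (x :: s) by rewrite -Ds size_rot.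
case: s => [|y [|z s]] // in Ds Us Nx Mx * => _.
have next_x : next c x = y by rewrite Nx /= eqxx.
have xy's u : u \in [:: y, z & s] -> u != x.
  by apply: contraL => /eqP->; case/andP: Us.
have xz : x != z by rewrite eq_sym xy's // !inE eqxx orbT.
have next_y : next c y = z by rewrite Nx /= (negPf (xy's y _)) ?eqxx ?mem_head.
have step u : u \in [:: y, z & s] -> e x y u (next c u).
  move=> su; rewrite /e cycle_edge_next; last by rewrite Mx inE su orbT.
  (* As [u] is not [x], only the backward step from [y] to [x] could reuse the edge; but [y] is
     followed by [z], distinct from [x] because the cycle has at least three vertices. *)
  rewrite /same_edge (negPf (xy's _ su)) /=.
  by apply/negP=> /andP[/eqP->]; rewrite next_y eq_sym (negPf xz).
have: path (frel (next c)) x (rcons [:: y, z & s] x).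
  by rewrite -[path _ _ _]/(fcycle (next c) [:: x, y, z & s]) -Ds rot_cycle
             cycle_next.
rewrite rcons_path => /andP[next_s /eqP next_last].
have {}next_s: path (frel (next c)) y (z :: s) by case/andP: next_s.
rewrite next_x; exists (rcons (z :: s) x); last by rewrite last_rcons.
(* The closing step into [x] is treated apart, since [step] applies only to vertices of the list
   without [x]. *)
have := step _ (mem_last y (z :: s)).
rewrite rcons_path [next _ _]next_last => ->; rewrite andbT.
apply: (sub_in_path (P := mem [:: y, z & s]) (e := frel (next c))) _ next_s.
- by move=> u v su _ /eqP <-; apply: step.
- exact/allP.
Qed.

(** Shortening the walk gives a simple path from [a] to [b], which the edge [a b] closes. The last
    conclusion serves to keep chosen edges off the cycle, by removing them from [e] beforehand. *)
Lemma cycle_of_reach e a b :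
    symmetric e -> subrel e G -> ~~ e a b -> adj G a b -> reach e a b ->
  exists c, [/\ is_cycle G c, cycle_edge c a b &
    forall x y, cycle_edge c x y -> e x y || same_edge a b x y].
Proof.
move=> e_sym eG e'ab Gab [p0 /shortenP[p ep Up _] Db].
have b_p : b \in a :: p by rewrite -Db mem_last.
have next_b : next (a :: p) b = a.
  by have := cycle_next Up; rewrite /= rcons_path Db => /andP[_ /eqP].
have ec : cycle (fun x y => e x y || same_edge a b x y) (a :: p).
  rewrite /= rcons_path Db /same_edge !eqxx /= !orbT andbT.
  by apply: sub_path ep => x y ->.
exists (a :: p); split.
- apply/and3P; split=> //; last first.
    apply: sub_cycle ec => x y /orP[/eG // | /orP[]/andP[/eqP-> /eqP->] //].
    by rewrite adj_sym.
  (* An empty [p] would make [a b] a loop; a one-vertex [p] would put [a b] in [e]. *)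
  case: (p) ep Db => [|x [|y q]] //= ep Db.
    by rewrite -Db adj_irr in Gab.
  by rewrite Db andbT (negPf e'ab) in ep.
- by rewrite /cycle_edge b_p next_b eqxx orbT.
move=> x y; apply: cycle_edge_rel ec => u v.
by rewrite e_sym same_edge_sym.
Qed.

End Cycles.

Lemma distinct_cycles_cover (V : eqType) (G : sgraph V)
    (Gdel : forall a b : V, adj G a b -> cactus (del_edge G a b))
    (c d : seq V) (a b x y : V) :
    is_cycle G c -> is_cycle G d -> ~ same_cycle c d ->
    cycle_edge c a b -> cycle_edge d a b -> adj G x y ->
  cycle_edge c x y || cycle_edge d x y.
Proof.
move=> Gc Gd c'd c_ab d_ab Gxy; apply/negPn/negP=> /norP[c'xy d'xy].
have [_ cact] := Gdel x y Gxy; apply: c'd.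
apply: (cact a b _ _ _ (is_cycle_del Gc c'xy) (is_cycle_del Gd d'xy)) => //.
(* The shared edge survives the deletion: it lies on [c], whereas [x y] does not. *)
rewrite /= /del_adj (cycle_edge_adj Gc c_ab).
by apply: contra c'xy => /(cycle_edge_same c) <-.
Qed.

Lemma cycle_exchange (V : eqType) (G : sgraph V) (c d : seq V) (a b x y : V) :
    is_cycle G c -> is_cycle G d ->
    cycle_edge c x y -> cycle_edge d x y ->
    cycle_edge c a b -> ~~ cycle_edge d a b ->
  exists z, [/\ is_cycle G z, cycle_edge z a b & ~~ cycle_edge z x y].
Proof.
move=> Gc Gd c_xy d_xy c_ab d'ab.
(* Both edges are deleted; a walk in [e] closed by [a b] then avoids [x y]. *)
pose e := del_edge (del_edge G a b) x y.
have e'ab : ~~ e a b by rewrite /= /del_adj /= /del_adj /same_edge !eqxx andbF.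
have eG : subrel e G by move=> u v /andP[/andP[]].
have xy'ab : ~~ same_edge a b x y.
  by apply: contra d'ab => /(cycle_edge_same d) <-.
have e_ab : reach e a b.
  (* The walk follows [c] without [a b]; a step along [x y] is replaced by the rest of [d], which
     avoids [a b] altogether. *)
  apply: reach_sub (reach_cycle_del Gc c_ab) => u v /andP[c_uv uv'ab].
  have [uv_xy | uv'xy] := boolP (same_edge x y u v); last first.
    exists [:: v] => //=.
    by rewrite /del_adj /= /del_adj (cycle_edge_adj Gc c_uv) uv'ab uv'xy.
  have: reach e x y.
    apply: reach_sub (reach_cycle_del Gd d_xy) => s t /andP[d_st st'xy].
    exists [:: t] => //=.
    rewrite /del_adj /= /del_adj (cycle_edge_adj Gd d_st) st'xy !andbT.
    by apply: contra d'ab => /(cycle_edge_same d) <-.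
  case/orP: uv_xy => /andP[/eqP-> /eqP->] //.
  by apply: reach_sym; apply: adj_sym.
have [z [Gz z_ab ez]] :=
  cycle_of_reach (@adj_sym _ e) eG e'ab (cycle_edge_adj Gc c_ab) e_ab.
exists z; split=> //; apply/negP => /ez; rewrite (negPf xy'ab) orbF.
by rewrite /= /del_adj /same_edge !eqxx andbF.
Qed.

Theorem theorem4 (V : eqType) (G : sgraph V)
    (Gconn : connected G)
    (Gnot_cactus : ~ cactus G)
    (Gdel_cactus : forall a b : V, adj G a b -> cactus (del_edge G a b))
    (a1 b1 a2 b2 : V) (e1 : adj G a1 b1) (e2 : adj G a2 b2) :
  exists c : seq V,
    [/\ is_cycle G c, cycle_edge c a1 b1 & cycle_edge c a2 b2].
Proof.
(* If no cycle contained both edges, [G] would be a cactus, because two distinct cycles sharing an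
   edge [x y] produce such a cycle. *)
apply: NNPP => no_cycle; apply: Gnot_cactus; split=> // x y _ c d.
move=> Gc Gd c_xy d_xy; apply: NNPP => c'd; apply: no_cycle.
have cover := distinct_cycles_cover Gdel_cactus.
wlog c_1 : c d Gc Gd c_xy d_xy c'd / cycle_edge c a1 b1.
  move=> IH; have /orP[c_1 | d_1] := cover _ _ _ _ _ _ Gc Gd c'd c_xy d_xy e1.
    exact: (IH c d).
  by apply: (IH d c) => // dc; apply: c'd => u v; rewrite dc.
have [c_2 | c'2] := boolP (cycle_edge c a2 b2); first by exists c.
have d_2 : cycle_edge d a2 b2.
  by have := cover _ _ _ _ _ _ Gc Gd c'd c_xy d_xy e2; rewrite (negPf c'2).
have [d_1 | d'1] := boolP (cycle_edge d a1 b1); first by exists d.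
have [z [Gz z_1 z'xy]] := cycle_exchange Gc Gd c_xy d_xy c_1 d'1.
(* The edge [x y] tells [c] and [z] apart, and [a1 b1] is now the shared edge for the covering
   argument. *)
have c'z : ~ same_cycle c z by move=> cz; rewrite -cz c_xy in z'xy.
exists z; split=> //.
by have := cover _ _ _ _ _ _ Gc Gz c'z c_1 z_1 e2; rewrite (negPf c'2).
Qed.
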